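(* Up to isomorphism there are exactly $238$ hyperbolic Dynkin diagrams of rank between $3$ and $10$ (inclusive), and exactly $142$ of these are symmetrizable (including the symmetric ones).
   Context: A generalized Cartan matrix is an integer matrix $A=(a_{ij})_{i,j=1,\dots,\ell}$ with $a_{ii}=2$, $a_{ij}\le 0$ for $i\ne j$, and $a_{ij}=0$ implies $a_{ji}=0$. Its Dynkin diagram $\mathcal{D}$ is the graph on vertices $v_1,\dots,v_\ell$ in which $v_i,v_j$ ($i\neq j$) are joined by an edge iff $a_{ij}\neq 0$, each edge being decorated so as to record the pair $(a_{ij},a_{ji})$. Two Dynkin diagrams are isomorphic if their generalized Cartan matrices can be obtained from each other by reordering the index set (simultaneous permutation of rows and columns). In particular a diagram and its dual (the diagram of the transposed matrix) are counted separately unless they are isomorphic. The rank of $\mathcal{D}$ is the number of vertices $\ell$. A subdiagram is the diagram of a principal submatrix; it is proper if at least one vertex is deleted. A connected diagram is of finite type if all principal minors of its matrix are positive, and of affine type if all proper principal minors are positive and the determinant is $0$. A connected Dynkin diagram is hyperbolic if it is of neither finite nor affine type but every proper connected subdiagram is of finite or affine type. A Dynkin diagram is symmetrizable if there exist nonzero rational numbers $d_1,\dots,d_\ell$ such that $\mathrm{diag}(d_1,\dots,d_\ell)A$ is symmetric. *)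

(* Defs.v *)
From mathcomp Require Import all_boot all_order all_algebra.

Set Implicit Arguments.
Unset Strict Implicit.
Unset Printing Implicit Defensive.

Import Order.TTheory GRing.Theory Num.Theory.
Local Open Scope ring_scope.

Definition is_gcm (n : nat) (A : 'M[int]_n) : bool :=
  [&& [forall i, A i i == 2],
      [forall i, forall j, (i != j) ==> (A i j <= 0)]
    & [forall i, forall j, (A i j == 0) ==> (A j i == 0)]].

(* A decorated Dynkin diagram carries exactly the same data as its matrix: the
   entry A i j (i != j) is recovered from the decoration of the edge {i, j},
   and is 0 when there is no edge. A diagram is thus represented by its
   generalized Cartan matrix. *)
Record dynkin := Dynkin {
  rank : nat;
  cartan : 'M[int]_rank;
  cartan_gcm : is_gcm cartan }.

Definition edge (D : dynkin) : rel 'I_(rank D) :=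
  [rel i j | (i != j) && (cartan D i j != 0)].
Arguments edge : clear implicits.

(* The empty diagram is not connected. *)
Definition connected (D : dynkin) : bool :=
  (0 < rank D)%N && [forall i, forall j, connect (edge D) i j].

Definition isomorphic (D E : dynkin) : Prop :=
  exists f : 'I_(rank D) -> 'I_(rank E),
    bijective f /\ forall i j, cartan E (f i) (f j) = cartan D i j.

Definition principal_submx (n : nat) (A : 'M[int]_n) (S : {set 'I_n}) :
    'M[int]_#|S| :=
  mxsub (@enum_val _ (mem S)) (@enum_val _ (mem S)) A.

Lemma principal_submx_gcm (n : nat) (A : 'M[int]_n) (S : {set 'I_n}) :
  is_gcm A -> is_gcm (principal_submx A S).
Proof.
case/and3P=> /forallP diagA /forallP offA /forallP zeroA; apply/and3P; split.
- by apply/forallP=> i; rewrite mxE.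
- apply/forallP=> i; apply/forallP=> j; apply/implyP=> neq_ij; rewrite mxE.
  by apply: (implyP (forallP (offA _) _)); rewrite (inj_eq enum_val_inj).
- apply/forallP=> i; apply/forallP=> j; rewrite !mxE.
  exact: (forallP (zeroA _)).
Qed.

Definition subdiagram (D : dynkin) (S : {set 'I_(rank D)}) : dynkin :=
  Dynkin (principal_submx_gcm S (cartan_gcm D)).

(* For S = set0 this is the determinant of the empty matrix, namely 1, so that
   quantifying over all S, empty or not, makes no difference to the positivity
   conditions below. *)
Definition principal_minor (D : dynkin) (S : {set 'I_(rank D)}) : int :=
  \det (principal_submx (cartan D) S).

Definition finite_type (D : dynkin) : bool :=
  connected D && [forall S : {set 'I_(rank D)}, 0 < principal_minor S].

Definition affine_type (D : dynkin) : bool :=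
  [&& connected D,
      [forall S : {set 'I_(rank D)}, (S \proper [set: 'I_(rank D)]) ==>
                 (0 < principal_minor S)]
    & \det (cartan D) == 0].

Definition hyperbolic (D : dynkin) : bool :=
  [&& connected D, ~~ finite_type D, ~~ affine_type D
    & [forall S : {set 'I_(rank D)},
         (S \proper [set: 'I_(rank D)]) && connected (subdiagram S) ==>
         finite_type (subdiagram S) || affine_type (subdiagram S)]].

Definition symmetrizable (D : dynkin) : Prop :=
  exists d : 'rV[rat]_(rank D),
    (forall i, d 0 i != 0) /\
    (let B := diag_mx d *m map_mx intr (cartan D) in B^T = B).

(* The objects satisfying P form exactly n classes modulo R: there are n of
   them, pairwise unrelated, to which every other one is related. This counts
   classes provided that R is an equivalence relation, which is shown below
   for isomorphic. *)
Definition exactly_up_to (T : Type) (R : T -> T -> Prop) (P : T -> Prop)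
    (n : nat) : Prop :=
  exists s : 'I_n -> T,
    [/\ forall i, P (s i),
        forall i j, R (s i) (s j) -> i = j
      & forall x, P x -> exists i, R x (s i)].

Lemma isomorphic_refl (D : dynkin) : isomorphic D D.
Proof. by exists id; split=> //; exists id. Qed.

Lemma isomorphic_sym (D E : dynkin) : isomorphic D E -> isomorphic E D.
Proof.
case=> f [[g fK gK] fA]; exists g; split; first by exists f.
by move=> i j; rewrite -fA !gK.
Qed.

Lemma isomorphic_trans (D E F : dynkin) :
  isomorphic D E -> isomorphic E F -> isomorphic D F.
Proof.
case=> f [bij_f fA] [g [bij_g gA]]; exists (g \o f); split.
  exact: bij_comp.
by move=> i j; rewrite /= gA fA.
Qed.

(* Main.v *)
Require Import Defs.
From Stdlib Require Import ZArith.
From mathcomp Require Import all_boot all_order all_algebra.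
From mathcomp Require Import perm zify ssrZ ring.

(** The diagrams are enumerated by an algorithm that is proved correct and then
    evaluated.

    A connected graph with at least two vertices has a vertex whose removal
    leaves it connected ([linked_noncut]).  Finite or affine type passes to
    connected subdiagrams ([finaff_sub]), and the proper connected subdiagrams
    of a hyperbolic diagram are finite or affine by definition.  Hence every
    finite, affine or hyperbolic diagram of rank n + 1 arises from a finite or
    affine diagram of rank n by adjoining one vertex.  Two joined vertices of
    such a diagram carry entries a, b < 0 with 4 - a b >= 0 as soon as they
    span a finite or affine subdiagram, which for a hyperbolic diagram is
    ensured by rank at least 3.  This leaves nine possible bonds
    ([tame_bond]), so that each rank is obtained from the previous one by a
    finite search ([step_complete]).  The row of the new vertex is built entry
    by entry and given up as soon as the vertices treated so far span a
    connected diagram with negative determinant.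

    The types are decided from their definition, by computing all principal
    minors ([laplaceE], [finaff_inP], [hyper_inP]).  Isomorphism is decided by
    backtracking ([same_matchingP]); the lists contain one diagram of each
    class, so that counting classes is counting entries
    ([exactly_catalogue]).

    In a connected diagram the equations d_i a_ij = d_j a_ji determine d up to
    a scalar ([symmetrizer_unique]), and testing one vector, computed along the
    construction of the diagram, decides symmetrizability
    ([symmetrized_by_candidateP]).

    All this is done with integer-valued functions on pairs of natural numbers
    and with lists of vertices; subdiagrams and renumberings are then just
    other lists. *)

Set Implicit Arguments.
Unset Strict Implicit.
Unset Printing Implicit Defensive.

Import GRing.Theory.

Delimit Scope Z_scope with ZZ.

(** * Principal minors of integer arrays *)

(** The cofactor expansion along a column [a].  The rows already passed are
    kept in reverse order in [pre], and the sign alternates because the value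
    of the remaining expansion is subtracted.  Zero entries are tested so that
    their cofactors are not evaluated. *)
Fixpoint alternating_expansion (F : seq nat -> Z) (a : nat -> Z) (pre rows : seq nat) : Z :=
  if rows is r :: rows' then
    let rest := alternating_expansion F a (r :: pre) rows' in
    if Z.eqb (a r) 0 then Z.opp rest
    else Z.sub (Z.mul (a r) (F (catrev pre rows'))) rest
  else 0%ZZ.

Fixpoint laplace (A : nat -> nat -> Z) (cols rows : seq nat) : Z :=
  if cols is c :: cols' then alternating_expansion (laplace A cols') (A^~ c) [::] rows
  else 1%ZZ.

Definition minor (A : nat -> nat -> Z) (s : seq nat) : Z := laplace A s s.

Lemma alternating_expansionE F a pre rows :
  alternating_expansion F a pre rows =
  (\sum_(i < size rows) (-1) ^+ i * (a (nth 0%N rows i) *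
     F (catrev pre (take i rows ++ drop i.+1 rows))))%R.
Proof.
elim: rows pre => [|r rows IH] pre /=; first by rewrite big_ord0.
rewrite big_ord_recl /= expr0 mul1r drop0.
have -> : (\sum_(i < size rows) (-1) ^+ bump 0%N i * (a (nth 0 rows i) *
    F (catrev (r :: pre) (take i rows ++ drop i.+1 rows))) =
  - alternating_expansion F a (r :: pre) rows)%R.
  rewrite IH -GRing.sumrN; apply: eq_bigr => i _.
  by rewrite /bump /= add1n exprS mulN1r mulNr.
by case: Z.eqb_spec => [->|_] //; rewrite mul0r add0r.
Qed.

Lemma laplaceE A cols rows n :
  size cols = n -> size rows = n ->
  laplace A cols rows =
  (\det (\matrix_(i < n, j < n) A (nth 0%N rows i) (nth 0%N cols j)))%R.
Proof.
elim: cols rows n => [|c cols IH] rows n <- //= szr; first by rewrite det_mx00.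
rewrite (expand_det_col _ ord0) alternating_expansionE szr; apply: eq_bigr => i _.
rewrite !mxE /cofactor /= addn0 mulrCA; congr (_ * (_ * _))%R.
have lt_i : i < size rows by rewrite szr.
rewrite (IH _ (size cols)) //; last first.
  by rewrite size_cat size_take lt_i size_drop szr; have := ltn_ord i; lia.
congr (\det _)%R; apply/matrixP => j k; rewrite !mxE /=; congr (A _ _).
rewrite nth_cat size_take lt_i /bump; case: ltnP => ji.
  by rewrite nth_take // leqNgt ji.
by rewrite nth_drop addSn subnKC // leqNgt ltnNge ji.
Qed.

Lemma minorE A s n : size s = n ->
  minor A s = (\det (\matrix_(i < n, j < n) A (nth 0%N s i) (nth 0%N s j)))%R.
Proof. by move=> szs; apply: laplaceE. Qed.

(** Rows and columns undergo the same permutation, whose signature is squared. *)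
Lemma minor_perm A s t : perm_eq s t -> minor A s = minor A t.
Proof.
move=> /[dup] /perm_size szs; rewrite -[t]/(tval (in_tuple t)).
case/tuple_permP => p sE; rewrite (minorE _ szs) (@minorE _ t (size t)) //.
set B := (X in _ = (\det X)%R).
have -> : (\matrix_(i < size t, j < size t) A (nth 0%N s i) (nth 0%N s j) =
           row_perm p (col_perm p B))%R.
  have nthE i : (i < size t)%N -> forall k : 'I_(size t), i = k -> nth 0%N s i = nth 0%N t (p k).
    move=> lti k ->; rewrite sE (nth_map k) ?size_enum_ord // nth_ord_enum.
    by rewrite (tnth_nth 0%N).
  by apply/matrixP => i j; rewrite !mxE !(nthE _ _ _ erefl).
rewrite row_permE col_permE !det_mulmx !det_perm odd_permV mulrC -mulrA.
by rewrite -signr_addb addbb mulr1.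
Qed.

(** * Finite or affine, and hyperbolic, lists of vertices *)

(** Connectedness in terms of cuts: a set of vertices of [s] that is closed
    under adjacency is empty or everything.  This form is immediate to transport
    and does not mention paths. *)
Definition linked (A : nat -> nat -> Z) (s : seq nat) : Prop :=
  s != [::] /\ forall p : pred nat,
    {in s &, forall x y, p x -> A x y <> 0%ZZ -> p y} ->
    {in s &, forall x y, p x -> p y}.

(** Finite or affine type in one condition: the two differ only in the sign of
    the whole determinant, which must be positive or zero. *)
Definition finaff (A : nat -> nat -> Z) (s : seq nat) : Prop :=
  [/\ linked A s, (0 <= minor A s)%ZZ &
      forall t, uniq t -> {subset t <= s} -> (size t < size s)%N ->
      (0 < minor A t)%ZZ].

Definition hyper (A : nat -> nat -> Z) (s : seq nat) : Prop :=
  [/\ linked A s, ~ finaff A s &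
      forall t, uniq t -> {subset t <= s} -> (size t < size s)%N ->
      linked A t -> finaff A t].

Lemma linked_eq_mem A s t : s =i t -> linked A s -> linked A t.
Proof.
move=> st [s0 sP]; split.
  by case: s st s0 {sP} => // x s /(_ x); rewrite mem_head; case: t.
move=> p closed_p x y; rewrite -!st; apply: sP => u v su sv.
by apply: closed_p; rewrite -st.
Qed.

Lemma finaff_perm A s t : perm_eq s t -> finaff A s -> finaff A t.
Proof.
move=> st [ls ms sP]; split; first exact: linked_eq_mem (perm_mem st) ls.
  by rewrite -(minor_perm A st).
move=> u uu ut; rewrite -(perm_size st); apply: sP => //.
by move=> x /ut; rewrite (perm_mem st).
Qed.

Lemma hyper_perm A s t : perm_eq s t -> hyper A s -> hyper A t.
Proof.
move=> st [ls ns sP]; split; first exact: linked_eq_mem (perm_mem st) ls.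
  by move=> ft; apply: ns; apply: finaff_perm ft; rewrite perm_sym.
move=> u uu ut; rewrite -(perm_size st); apply: sP => //.
by move=> x /ut; rewrite (perm_mem st).
Qed.

(** Minors of a subdiagram are minors of the diagram, and those of a proper
    subdiagram are all positive, its own determinant included. *)
Lemma finaff_sub A s t : uniq s -> finaff A s -> uniq t -> {subset t <= s} -> linked A t ->
  finaff A t.
Proof.
move=> us fs ut ts lt; have [ls ms sP] := fs.
have [lt_ts|] := ltnP (size t) (size s); last first.
  move=> /(uniq_min_size ut ts) [_ ts']; apply: finaff_perm fs.
  by apply: uniq_perm => // x; rewrite ts'.
split=> //; first by have := sP t ut ts lt_ts; lia.
move=> u uu us' ltut; apply: sP => //; last exact: ltn_trans ltut _.
by move=> x /us' /ts.
Qed.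

(** The notions above are invariant under an injective renaming [g] of the
    vertices. *)
Section Transport.
Variables (A B : nat -> nat -> Z) (g : nat -> nat) (s : seq nat).
Hypothesis g_inj : {in s &, injective g}.
Hypothesis AB : {in s &, forall x y, A x y = B (g x) (g y)}.

Lemma minor_map t : {subset t <= s} -> minor A t = minor B (map g t).
Proof.
move=> ts; rewrite (@minorE _ t (size t)) // (@minorE _ (map g t) (size t)) ?size_map //.
congr (\det _)%R; apply/matrixP => i j; rewrite !mxE !(nth_map 0%N) //.
by apply: AB; apply: ts; apply: mem_nth.
Qed.

Lemma linked_map t : {subset t <= s} -> linked A t <-> linked B (map g t).
Proof.
move=> ts; have m0 : (map g t == [::]) = (t == [::]) by case: t {ts}.
split=> -[t0 tP]; split; rewrite ?m0 // -?m0 //.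
  move=> p closed_p _ _ /mapP[x tx ->] /mapP[y ty ->].
  apply: (tP (p \o g)) => // u v tu tv pu; rewrite AB ?ts //.
  by apply: closed_p => //; apply: map_f.
move=> p closed_p x y tx ty px.
(* The image under [g] of the part of [t] where [p] holds. *)
pose q z := has (fun w => p w && (g w == z)) t.
have qg w : w \in t -> q (g w) = p w.
  move=> tw; apply/hasP/idP => [[w' tw' /andP[pw' /eqP]]|pw].
    by move/(g_inj (ts _ tw') (ts _ tw)) <-.
  by exists w => //; rewrite pw eqxx.
rewrite -qg //; apply: (tP q) (map_f g tx) (map_f g ty) _; last by rewrite qg.
move=> _ _ /mapP[u tu ->] /mapP[v tv ->]; rewrite !qg // -AB ?ts //.
exact: closed_p.
Qed.

Lemma sub_map t u : {subset t <= s} -> uniq u -> {subset u <= map g t} ->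
  exists v, [/\ u = map g v, uniq v & {subset v <= t}].
Proof.
move=> ts uu ut; exists (map (fun y => nth 0%N t (index y (map g t))) u).
have gE : {in u, forall y, g (nth 0%N t (index y (map g t))) = y}.
  by move=> y /ut ty; rewrite -(nth_map _ 0%N) ?nth_index // -(size_map g) index_mem.
have uE : map g [seq nth 0%N t (index y (map g t)) | y <- u] = u.
  by rewrite -map_comp -[RHS]map_id; apply/eq_in_map.
split=> //; first by rewrite -uE in uu; exact: map_uniq uu.
move=> _ /mapP[y uy ->]; apply: mem_nth; rewrite -(size_map g) index_mem.
exact: ut.
Qed.

Lemma finaff_map t : {subset t <= s} -> finaff A t <-> finaff B (map g t).
Proof.
move=> ts; split=> -[lt mt tP]; split.
- exact/linked_map.
- by rewrite -minor_map.
- move=> u uu ut; have [v [-> uv vt]] := sub_map ts uu ut.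
  rewrite !size_map -minor_map; first exact: tP.
  by move=> x /vt /ts.
- exact/linked_map.
- by rewrite minor_map.
- move=> u uu ut ltu; rewrite minor_map; last by move=> x /ut /ts.
  apply: tP; rewrite ?size_map // ?map_inj_in_uniq //.
    by move=> x y /ut /ts sx /ut /ts sy; apply: g_inj.
  by move=> _ /mapP[x ux ->]; apply/map_f/ut.
Qed.

Lemma hyper_map t : {subset t <= s} -> hyper A t <-> hyper B (map g t).
Proof.
move=> ts; split=> -[lt nt tP]; split.
- exact/linked_map.
- by move/finaff_map => /(_ ts).
- move=> u uu ut; have [v [-> uv vt]] := sub_map ts uu ut.
  have vs : {subset v <= s} by move=> x /vt /ts.
  by rewrite !size_map => ltv /linked_map lv; apply/finaff_map => //; apply: tP => //; apply: lv.
- by apply/linked_map.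
- by move/finaff_map => /(_ ts).
- move=> u uu ut ltu; have us : {subset u <= s} by move=> x /ut /ts.
  move=> /linked_map lu; apply/finaff_map => //; apply: tP; last exact: lu.
  + by rewrite map_inj_in_uniq // => x y /us sx /us sy; apply: g_inj.
  + by move=> _ /mapP[x ux ->]; apply/map_f/ut.
  + by rewrite !size_map.
Qed.
End Transport.

(** * Deciding the type of a diagram *)

(** Breadth-first search with fuel [k]: the vertices of [rest] adjacent to
    [front] form the next front. *)
Fixpoint reach (A : nat -> nat -> Z) (k : nat) (front rest : seq nat) : bool :=
  if rest is [::] then true else
  if k is k'.+1 then
    let near y := has (fun x => ~~ Z.eqb (A x y) 0) front in
    reach A k' (filter near rest) (filter (predC near) rest)
  else false.

Definition conn (A : nat -> nat -> Z) (s : seq nat) : bool :=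
  if s is x :: s' then reach A (size s') [:: x] s' else false.

Definition zero_sym (A : nat -> nat -> Z) (s : seq nat) : Prop :=
  {in s &, forall x y, A x y = 0%ZZ -> A y x = 0%ZZ}.

(** A set closed under adjacency that contains the front contains all that the
    search reaches. *)
Lemma reach_closed A (s : seq nat) (p : pred nat) k (front rest : seq nat) :
  {in s &, forall x y, p x -> A x y <> 0%ZZ -> p y} ->
  {subset front <= s} -> {subset rest <= s} ->
  reach A k front rest -> {in front, forall x, p x} -> {in rest, forall x, p x}.
Proof.
move=> closed_p; elim: k front rest => [|k IH] front [|y rest] // fs rs.
set r := y :: rest in rs *.
pose near z := has (fun x => ~~ Z.eqb (A x z) 0) front.
change (reach A k.+1 front r) with
  (reach A k (filter near r) (filter (predC near) r)) => reach_r pf.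
have pn : {in filter near r, forall x, p x}.
  move=> z; rewrite mem_filter => /andP[/hasP[x fx nA] rz].
  apply: (closed_p x z (fs x fx) (rs z rz) (pf x fx)).
  by move=> A0; rewrite A0 in nA.
have pc : {in filter (predC near) r, forall x, p x}.
  apply: (IH (filter near r)) => // z; rewrite mem_filter => /andP[_]; exact: rs.
move=> z rz; have [nz|nz] := boolP (near z).
  by apply: pn; rewrite mem_filter nz.
by apply: pc; rewrite mem_filter /= nz.
Qed.

(** A closed set either contains the starting vertex, hence everything, or
    misses it; in the second case its complement, closed because adjacency is
    symmetric, contains everything. *)
Lemma conn_linked A (s : seq nat) : zero_sym A s -> conn A s -> linked A s.
Proof.
case: s => // x0 s zs cs; split=> // p closed_p.
have [px0|npx0] := boolP (p x0).
  move=> x y _ sy _; move: sy; rewrite inE => /predU1P[->//|sy].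
  apply: (reach_closed closed_p _ _ cs) => //.
  - by move=> z; rewrite inE => /eqP->; rewrite mem_head.
  - by move=> z sz; rewrite inE sz orbT.
  - by move=> z; rewrite inE => /eqP->.
have np : {in s, forall x, ~~ p x}.
  apply: (@reach_closed A (x0 :: s) (predC p) _ _ _ _ _ _ cs) => //.
  - move=> x y sx sy /= npx Axy; apply: contra npx => py; apply: closed_p py _ => //.
    by move=> Ayx; apply/Axy/zs.
  - by move=> z; rewrite inE => /eqP->; rewrite mem_head.
  - by move=> z sz; rewrite inE sz orbT.
  - by move=> z; rewrite inE => /eqP->.
move=> x y; rewrite inE => /predU1P[->|/np]; first by rewrite (negPf npx0).
by move/negPf->.
Qed.

(** If no vertex of [rest] is adjacent to [front], then the visited vertices
    form a closed set, which misses [rest].  So the search only stops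
    when [rest] is empty, and [rest] decreases at each round. *)
Lemma linked_reach A (s seen front rest : seq nat) k :
  uniq s -> linked A s -> perm_eq s (seen ++ front ++ rest) ->
  (0 < size (seen ++ front))%N -> (size rest <= k)%N ->
  {in seen & rest, forall x y, A x y = 0%ZZ} ->
  reach A k front rest.
Proof.
move=> us [_ sP]; elim: k seen front rest => [|k IH] seen front [|y rest] // sE.
move=> nz szk A0; set r := y :: rest in sE szk A0 *.
pose near z := has (fun x => ~~ Z.eqb (A x z) 0) front.
change (reach A k (filter near r) (filter (predC near) r)).
have sm x : (x \in s) = [|| x \in seen, x \in front | x \in r].
  by rewrite (perm_mem sE) !mem_cat.
have disj x : x \in r -> x \notin seen ++ front.
  move=> rx; move: us; rewrite (perm_uniq sE) catA cat_uniq => /and3P[_ + _].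
  by apply: contra => sx; apply/hasP; exists x.
apply: (IH (seen ++ front)).
- rewrite (permPl sE) catA perm_cat2l perm_sym.
  by apply: permEl; apply: perm_filterC.
- by rewrite !size_cat; move: nz; rewrite size_cat; lia.
- have hasn : has near r.
    apply: contraT => /hasPn nor.
    have x0s : {x0 | x0 \in seen ++ front}.
      by case: (seen ++ front) nz => // x0 l _; exists x0; apply: mem_head.
    case: x0s => x0 x0s; have := disj y (mem_head _ _).
    suff -> : y \in seen ++ front by [].
    apply: (sP (mem (seen ++ front)) _ x0 y) => //; last first.
    - by rewrite sm mem_head !orbT.
    - by rewrite sm orbA -mem_cat x0s.
    move=> u v su sv /= uin Auv; move: sv; rewrite sm orbA -mem_cat.
    case/orP=> // rv; case: Auv; move: uin; rewrite mem_cat.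
    case/orP=> [useen|uf]; first exact: A0.
    by have /hasPn/(_ u uf) := nor v rv; rewrite negbK; case: Z.eqb_spec.
  move: hasn; rewrite has_count -size_filter => hasn.
  have := count_predC near r; rewrite -!size_filter /=; move: hasn.
  rewrite /= ; move: szk; rewrite /=; lia.
- move=> u v; rewrite mem_cat mem_filter => uin /andP[/hasPn nv rv].
  case/orP: uin => [us'|uf]; first exact: A0.
  by have := nv u uf; rewrite negbK; case: Z.eqb_spec.
Qed.

Lemma linked_conn A (s : seq nat) : uniq s -> linked A s -> conn A s.
Proof.
case: s => [|x s] us ls /=; first by case: ls.
exact: (@linked_reach A (x :: s) [::] [:: x] s).
Qed.

Lemma linkedP A (s : seq nat) : uniq s -> zero_sym A s -> reflect (linked A s) (conn A s).
Proof. by move=> us zs; apply: (iffP idP); [apply: conn_linked|apply: linked_conn]. Qed.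

Fixpoint sublists (s : seq nat) : seq (seq nat) :=
  if s is x :: s' then let r := sublists s' in map (cons x) r ++ r else [:: [::]].

Lemma sublists_subseq s t : t \in sublists s -> subseq t s.
Proof.
elim: s t => [|x s IH] t /=; first by rewrite inE.
rewrite mem_cat => /orP[/mapP[u /IH us ->]|/IH ts]; first by rewrite /= eqxx.
exact: subseq_trans ts (subseq_cons _ _).
Qed.

Lemma filter_sublists p s : filter p s \in sublists s.
Proof.
elim: s => //= x s IH; rewrite mem_cat; case: (p x); rewrite ?IH ?orbT //.
by rewrite map_f.
Qed.

Lemma sublists_perm (s t : seq nat) : uniq s -> uniq t -> {subset t <= s} ->
  exists2 t', t' \in sublists s & perm_eq t t'.
Proof.
move=> us ut ts; exists (filter (mem t) s); first exact: filter_sublists.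
apply: uniq_perm; rewrite ?filter_uniq // => x; rewrite mem_filter /=.
by apply/idP/andP => [tx|[]//]; split=> //; apply: ts.
Qed.

(** The obstructions to positivity, computed once for [s] and then compared with
    each of its sublists. *)
Definition nonpos (A : nat -> nat -> Z) (s : seq nat) : seq (seq nat) :=
  filter (fun t => Z.leb (minor A t) 0) (sublists s).

(** The conditionals, instead of boolean connectives, avoid the evaluation of
    determinants that are irrelevant to the answer. *)
Definition finaff_in (A : nat -> nat -> Z) (N : seq (seq nat)) (t : seq nat) : bool :=
  if conn A t then
    if Z.leb 0 (minor A t) then
      all (fun u => (size u < size t)%N ==> ~~ all (mem t) u) N
    else false
  else false.

Lemma finaff_inP A (s t : seq nat) : uniq s -> zero_sym A s -> t \in sublists s ->
  reflect (finaff A t) (finaff_in A (nonpos A s) t).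
Proof.
move=> us zs /sublists_subseq ts; have ut := subseq_uniq ts us.
have {}ts := mem_subseq ts.
have zt : zero_sym A t by move=> x y /ts sx /ts sy; apply: zs.
rewrite /finaff_in; case: (linkedP ut zt) => [lt|nlt]; last by constructor=> -[].
case: Z.leb_spec0 => [mt|nmt]; last by constructor=> -[].
apply: (iffP allP) => [tP|[_ _ tP] u].
  split=> // u uu ut' ltu; have [u' u's uu'] := sublists_perm us uu (fun x h => ts x (ut' x h)).
  rewrite (minor_perm _ uu'); have := tP u'; rewrite mem_filter u's andbT.
  case: Z.leb_spec => // _ /(_ isT); rewrite -(perm_size uu') ltu /= -(perm_all _ uu').
  by move/negP; case; apply/allP.
rewrite mem_filter => /andP[/Z.leb_spec0 mu su]; apply/implyP => ltu; apply/negP => /allP ut'.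
have := tP u (subseq_uniq (sublists_subseq su) us) ut' ltu; lia.
Qed.

Definition hyper_in (A : nat -> nat -> Z) (N : seq (seq nat)) (s : seq nat) : bool :=
  if conn A s then
    if finaff_in A N s then false else
    all (fun t => if (size t < size s)%N then
                    if conn A t then finaff_in A N t else true
                  else true) (sublists s)
  else false.

Lemma hyper_inP A (s : seq nat) : uniq s -> zero_sym A s ->
  reflect (hyper A s) (hyper_in A (nonpos A s) s).
Proof.
move=> us zs; rewrite /hyper_in; case: (linkedP us zs) => [ls|nls]; last by constructor=> -[].
have ss : s \in sublists s by rewrite -{1}(filter_predT s) filter_sublists.
case: (finaff_inP us zs ss) => [fs|nfs]; first by constructor=> -[].
apply: (iffP allP) => [tP|[_ _ tP] t ts].
  split=> // t ut ts ltt lt; have [t' t's tt'] := sublists_perm us ut ts.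
  have := tP t' t's; rewrite -(perm_size tt') ltt.
  rewrite linked_conn; last exact: linked_eq_mem (perm_mem tt') lt.
    by move/(finaff_inP us zs t's); apply: finaff_perm; rewrite perm_sym.
  by rewrite -(perm_uniq tt').
case: ltnP => // ltt; have ut := subseq_uniq (sublists_subseq ts) us.
have st := mem_subseq (sublists_subseq ts).
case: linkedP => //; first by move=> x y /st sx /st sy; apply: zs.
by move=> lt; apply/finaff_inP => //; apply: tP.
Qed.

(** * Diagrams as integer arrays *)

Definition cartanZ (D : dynkin) (i j : nat) : Z :=
  match insub i, insub j with
  | Some i', Some j' => Z_of_int (cartan D i' j')
  | _, _ => 0%ZZ
  end.

Lemma cartanZE D (i j : 'I_(rank D)) : cartanZ D i j = Z_of_int (cartan D i j).
Proof. by rewrite /cartanZ !valK. Qed.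

Definition gcm (A : nat -> nat -> Z) (s : seq nat) : Prop :=
  [/\ {in s, forall x, A x x = 2%ZZ},
      {in s &, forall x y, x != y -> (A x y <= 0)%ZZ} & zero_sym A s].

Lemma cartanZ_gcm D : gcm (cartanZ D) (iota 0 (rank D)).
Proof.
have /and3P[/forallP d /forallP o /forallP z] := cartan_gcm D.
have io (i : nat) : i \in iota 0 (rank D) -> {i' : 'I_(rank D) | i = i'}.
  by rewrite mem_iota add0n => lti; exists (Ordinal lti).
split.
- by move=> _ /io[i ->]; rewrite cartanZE (eqP (d i)).
- move=> _ _ /io[i ->] /io[j ->] ij; rewrite cartanZE.
  by have /forallP/(_ j)/implyP/(_ ij) := o i; lia.
- move=> _ _ /io[i ->] /io[j ->]; rewrite !cartanZE => A0.
  have /forallP/(_ j)/implyP := z i; move/(_ _)/eqP => -> //; apply/eqP; lia.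
Qed.

Definition vals n (S : {set 'I_n}) : seq nat := map val (enum S).

Lemma size_vals n (S : {set 'I_n}) : size (vals S) = #|S|.
Proof. by rewrite size_map -cardE. Qed.

Lemma uniq_vals n (S : {set 'I_n}) : uniq (vals S).
Proof. by rewrite map_inj_uniq ?enum_uniq //; apply: val_inj. Qed.

Lemma sub_vals n (S : {set 'I_n}) : {subset vals S <= iota 0 n}.
Proof. by move=> _ /mapP[i _ ->]; rewrite mem_iota /=. Qed.

Lemma valsT n : vals [set: 'I_n] = iota 0 n.
Proof. by rewrite /vals enum_setT -enumT val_enum_ord. Qed.

Lemma nth_vals n (S : {set 'I_n}) (i : 'I_#|S|) : nth 0%N (vals S) i = enum_val i.
Proof. by rewrite (nth_map (enum_val i)) -?cardE // -enum_val_nth. Qed.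

Lemma valsP n (t : seq nat) : uniq t -> {subset t <= iota 0 n} ->
  exists S : {set 'I_n}, perm_eq (vals S) t.
Proof.
move=> ut tn; exists [set i | val i \in t].
apply: uniq_perm => //; first exact: uniq_vals.
move=> x; apply/mapP/idP => [[i + ->]|tx]; first by rewrite mem_enum inE.
have := tn x tx; rewrite mem_iota add0n => ltx.
by exists (Ordinal ltx) => //; rewrite mem_enum inE.
Qed.

Lemma principal_minorE D (S : {set 'I_(rank D)}) :
  Z_of_int (principal_minor S) = minor (cartanZ D) (vals S).
Proof.
rewrite (minorE _ (size_vals S)) -det_map_mx; congr (\det _)%R.
by apply/matrixP => i j; rewrite !mxE !nth_vals cartanZE.
Qed.

Lemma det_cartanE D : Z_of_int (\det (cartan D))%R = minor (cartanZ D) (iota 0 (rank D)).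
Proof.
rewrite (minorE _ (size_iota 0 _)) -det_map_mx; congr (\det _)%R.
by apply/matrixP => i j; rewrite !mxE !nth_iota // !add0n cartanZE.
Qed.

Lemma connectedP D : reflect (linked (cartanZ D) (iota 0 (rank D))) (connected D).
Proof.
have io (i : nat) : i \in iota 0 (rank D) -> {i' : 'I_(rank D) | i = i'}.
  by rewrite mem_iota add0n => lti; exists (Ordinal lti).
apply: (iffP andP) => [[n0 /forallP cD]|[n0 lD]].
  split; first by rewrite -size_eq0 size_iota -lt0n.
  move=> p closed_p _ _ /io[x ->] /io[y ->].
  have /forallP/(_ y)/connectP[q qP ->] := cD x.
  elim: q x qP => //= z q IH x /andP[/andP[xz /eqP Axz] qP] px.
  apply: IH qP _; apply: closed_p px _; rewrite ?mem_iota //= cartanZE.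
  by move=> A0; apply: Axz; lia.
split; first by rewrite -size_eq0 size_iota -lt0n in n0.
apply/forallP => i; apply/forallP => j.
pose p x := if insub x is Some x' then connect (edge D) i x' else false.
have : p j; last by rewrite /p valK.
apply: (lD p _ i); rewrite ?mem_iota //=; last by rewrite /p valK.
move=> _ _ /io[x ->] /io[y ->]; rewrite /p !valK cartanZE => ix Axy.
have [<- //|xy] := eqVneq x y.
apply: connect_trans ix (connect1 _); rewrite /edge /= xy /=.
by apply/eqP => A0; rewrite A0 in Axy.
Qed.

(** A subset corresponds to a list without repetition, up to reordering; the
    whole set is the only one that is not proper, and its minor is the
    determinant. *)
Lemma finaffP D :
  reflect (finaff (cartanZ D) (iota 0 (rank D))) (finite_type D || affine_type D).
Proof.
apply: (iffP idP) => [FA|[/connectedP cD mD tD]].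
  have proper_pos (S : {set 'I_(rank D)}) :
      S \proper [set: 'I_(rank D)] -> (0 < principal_minor S)%R.
    move=> pS; case/orP: FA => [/andP[_ /forallP]//|/and3P[_ /forallP/(_ S)]].
    by rewrite pS.
  split.
  - by apply/connectedP; case/orP: FA => [/andP[]|/and3P[]].
  - case/orP: FA => [/andP[_ /forallP/(_ setT)]|/and3P[_ _ /eqP D0]].
      by rewrite -valsT -principal_minorE; lia.
    by rewrite -det_cartanE D0.
  - move=> t ut tD; rewrite size_iota => ltt; have [S St] := valsP ut tD.
    rewrite -(minor_perm _ St) -principal_minorE.
    have := proper_pos S; rewrite properT.
    suff -> : S != [set: _] by move=> /(_ isT); lia.
    apply: contraTneq ltt => ST; rewrite -(perm_size St) ST size_vals cardsT card_ord.
    by rewrite ltnn.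
have proper_pos (S : {set 'I_(rank D)}) :
    S \proper [set: 'I_(rank D)] -> (0 < principal_minor S)%R.
  move=> /proper_card; rewrite cardsT card_ord => ltS.
  have := tD (vals S) (uniq_vals S) (@sub_vals _ S).
  by rewrite size_vals size_iota -principal_minorE => /(_ ltS); lia.
have [D0|D0] := eqVneq (\det (cartan D))%R 0%R; apply/orP; [right|left].
  apply/and3P; split=> //; last by rewrite D0.
  by apply/forallP => S; apply/implyP => /proper_pos.
apply/andP; split=> //; apply/forallP => S.
have [->|nT] := eqVneq S setT; last by apply: proper_pos; rewrite properT.
have : Z_of_int (principal_minor [set: 'I_(rank D)]) = Z_of_int (\det (cartan D)).
  by rewrite principal_minorE valsT -det_cartanE.
move: mD; rewrite -det_cartanE => mD /(can_inj Z_of_intK) ->; move: D0 mD; lia.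
Qed.

(** The vertices of a subdiagram are numbered by the enumeration of the subset;
    transporting along it identifies the subdiagram with the list of values of
    the subset. *)
Section Subdiagram.
Variables (D : dynkin) (S : {set 'I_(rank D)}).

Let g k := nth 0%N (vals S) k.

Let g_inj : {in iota 0 #|S| &, injective g}.
Proof.
move=> i j; rewrite !mem_iota !add0n /= => lti ltj /eqP.
by rewrite nth_uniq ?size_vals ?uniq_vals // => /eqP.
Qed.

Let gE : {in iota 0 #|S| &, forall x y, cartanZ (subdiagram S) x y = cartanZ D (g x) (g y)}.
Proof.
move=> i j; rewrite !mem_iota !add0n /= => lti ltj.
pose i' : 'I_(rank (subdiagram S)) := Ordinal lti.
pose j' : 'I_(rank (subdiagram S)) := Ordinal ltj.
rewrite /g -[i]/(val i') -[j]/(val j') cartanZE mxE.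
by rewrite !nth_vals cartanZE.
Qed.

Let map_g : map g (iota 0 #|S|) = vals S.
Proof. by rewrite -[RHS](mkseq_nth 0%N) size_vals. Qed.

Lemma connected_subdiagramP : reflect (linked (cartanZ D) (vals S)) (connected (subdiagram S)).
Proof.
by apply: (iffP (connectedP _)) => [/(linked_map g_inj gE)|lS];
  rewrite ?map_g => //; [apply|apply/(linked_map g_inj gE) => //; rewrite map_g].
Qed.

Lemma finaff_subdiagramP : reflect (finaff (cartanZ D) (vals S))
  (finite_type (subdiagram S) || affine_type (subdiagram S)).
Proof.
by apply: (iffP (finaffP _)) => [/(finaff_map g_inj gE)|lS];
  rewrite ?map_g => //; [apply|apply/(finaff_map g_inj gE) => //; rewrite map_g].
Qed.
End Subdiagram.

Lemma hyperbolicP D : reflect (hyper (cartanZ D) (iota 0 (rank D))) (hyperbolic D).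
Proof.
apply: (iffP and4P) => [[/connectedP cD nF nA /forallP sD]|[/connectedP cD nD tD]].
  split=> //; first by move/finaffP; rewrite (negPf nF) (negPf nA).
  move=> t ut tD; rewrite size_iota => ltt lt; have [S St] := valsP ut tD.
  apply: (finaff_perm St); apply/finaff_subdiagramP; apply: (implyP (sD S)).
  rewrite properT; apply/andP; split; last first.
    apply/connected_subdiagramP; apply: linked_eq_mem lt => x.
    by rewrite (perm_mem St).
  apply: contraTneq ltt => ST; rewrite -(perm_size St) ST size_vals cardsT card_ord.
  by rewrite ltnn.
have /norP[nF nA] : ~~ (finite_type D || affine_type D) by apply/finaffP.
split=> //; apply/forallP => S; apply/implyP => /andP[/proper_card + /connected_subdiagramP cS].
rewrite cardsT card_ord => ltS; apply/finaff_subdiagramP; apply: tD => //.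
- exact: uniq_vals.
- exact: sub_vals.
- by rewrite size_vals size_iota.
Qed.

(** * Adjoining a vertex *)

(** A linked proper sublist can be enlarged by a vertex adjacent to it and stays
    linked.  Starting from one vertex, this is repeated until a single
    vertex is left over. *)
Lemma linked_noncut A (s : seq nat) : uniq s -> zero_sym A s -> linked A s ->
  (1 < size s)%N -> exists v t, perm_eq s (v :: t) /\ linked A t.
Proof.
move=> us zs ls gt1.
have grow k t : (size s - size t <= k)%N -> uniq t -> {subset t <= s} ->
    linked A t -> (size t < size s)%N -> exists v t, perm_eq s (v :: t) /\ linked A t.
  elim: k t => [|k IH] t szk ut ts lt ltt; first by move: szk ltt; lia.
  have [u tu [w [sw tw Auw]]] : exists2 u, u \in t &
      exists w, [/\ w \in s, w \notin t & A u w <> 0%ZZ].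
    have /hasP[u tu /hasP[w sw /andP[tw Auw]]] :
        has (fun u => has (fun w => (w \notin t) && ~~ Z.eqb (A u w) 0) s) t.
      apply: contraT => /hasPn no.
      (* Otherwise [t] is closed under adjacency, hence all of [s]. *)
      have [t0 _] := lt; case: t t0 no ts ut ltt {szk lt} => // x t _ no ts ut ltt.
      have : {subset s <= x :: t}.
        move=> y sy; apply: (ls.2 (mem (x :: t)) _ x y) => //=; last 1 first.
        - exact: mem_head.
        - move=> a b sa sb ta Aab; apply: contraT => tb.
          have /hasPn/(_ b sb) := no a ta; rewrite tb /= negbK.
          by case: Z.eqb_spec.
        - by apply: ts; apply: mem_head.
      by move/(uniq_leq_size us); rewrite leqNgt ltt.
    exists u => //; exists w; split=> //; move=> A0; by rewrite A0 in Auw.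
  have lw : linked A (w :: t).
    split=> // p closed_p; case: lt => _ /(_ p) tP.
    have tc : {in t &, forall x y, p x -> p y}.
      by apply: tP => x y tx ty; apply: closed_p; rewrite inE ?tx ?ty orbT.
    have pwu : p w -> p u.
      move=> pw; apply: closed_p pw _; rewrite ?inE ?eqxx ?tu ?orbT // => Awu.
      by apply: Auw; apply: zs => //; apply: ts.
    have puw : p u -> p w.
      by move=> pu; apply: closed_p pu Auw; rewrite ?inE ?eqxx ?tu ?orbT.
    move=> x y; rewrite !inE => /predU1P[->|tx] /predU1P[->|ty] //.
    - by move/pwu; apply: tc.
    - by move=> px; apply/puw/(tc x).
    - exact: tc.
  have uw : uniq (w :: t) by rewrite /= tw.
  have ws : {subset w :: t <= s} by move=> x; rewrite inE => /predU1P[->//|/ts].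
  have [lts|ges] := ltnP (size t).+1 (size s).
    by apply: (IH (w :: t) _ uw ws lw lts); move: szk => /=; lia.
  exists w, t; split=> //; rewrite perm_sym; apply: uniq_perm => //.
  by have [] := uniq_min_size uw ws ges.
case: s us zs ls gt1 grow => // x s us zs ls gt1 grow.
apply: (grow (size (x :: s)) [:: x]) => //=; first by rewrite leq_subr.
- by move=> y; rewrite inE => /eqP->; apply: mem_head.
- by split=> // p _ y z; rewrite !inE => /eqP-> /eqP->.
Qed.

Definition bond : Type := (Z * Z)%type.

(** The pairs of nonpositive integers that vanish together and whose product is at
    most 4. *)
Definition bonds : seq bond :=
  [:: (0, 0); (-1, -1); (-1, -2); (-2, -1); (-1, -3); (-3, -1);
      (-1, -4); (-4, -1); (-2, -2)]%ZZ.

(** A diagram is the list of the rows of its vertices, the last adjoined vertex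
    first; the row of a vertex lists its bonds with the vertices that follow it,
    that is, those adjoined before it.  Adjoining a vertex is thus putting a row
    in front. *)
Definition diagram := seq (seq bond).

Fixpoint entry (M : diagram) (i j : nat) : Z :=
  match M, i, j with
  | [::], _, _ => 0%ZZ
  | _ :: _, 0, 0 => 2%ZZ
  | r :: _, 0, j'.+1 => (nth (0, 0)%ZZ r j').1
  | r :: _, i'.+1, 0 => (nth (0, 0)%ZZ r i').2
  | _ :: M', i'.+1, j'.+1 => entry M' i' j'
  end.

(** The consequence of the type of a diagram by which the search is pruned. *)
Definition tame (A : nat -> nat -> Z) (s : seq nat) : Prop :=
  forall u, uniq u -> {subset u <= s} -> linked A u -> (0 <= minor A u)%ZZ.

Definition proper_tame (A : nat -> nat -> Z) (s : seq nat) : Prop :=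
  forall u, uniq u -> {subset u <= s} -> (size u < size s)%N ->
  linked A u -> (0 <= minor A u)%ZZ.

Lemma finaff_tame A s : uniq s -> finaff A s -> tame A s.
Proof. by move=> us fs u uu u_s lu; have [] := finaff_sub us fs uu u_s lu. Qed.

Lemma hyper_tame A s : hyper A s -> proper_tame A s.
Proof. by move=> [_ _ sP] u uu u_s ltu lu; have [] := sP u uu u_s ltu lu. Qed.

Lemma minor2 A x y :
  minor A [:: x; y] = (A x x * A y y - A x y * A y x)%ZZ.
Proof.
rewrite (@minorE _ _ 2) // (expand_det_row _ ord0) !big_ord_recl big_ord0.
by rewrite /cofactor !det_mx11 !mxE /= expr0 expr1 mul1r mulN1r addr0 mulrN.
Qed.

(** The determinant of a rank two diagram is 4 - a b, so negative a and b
    satisfy a b <= 4. *)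
Lemma tame_bond A s x y : gcm A s -> x \in s -> y \in s -> x != y ->
  (linked A [:: x; y] -> (0 <= minor A [:: x; y])%ZZ) ->
  (A x y, A y x) \in bonds.
Proof.
move=> [diagA offA zA] sx sy xy mxy.
have yx : y != x by rewrite eq_sym.
have := offA x y sx sy xy; have := offA y x sy sx yx.
have := zA x y sx sy; have := zA y x sy sx.
have [Axy|Axy] := Z.eqb_spec (A x y) 0.
  by move=> _ /(_ Axy) -> _ _; rewrite Axy.
have {}mxy : (0 <= minor A [:: x; y])%ZZ.
  apply: mxy; split=> // p closed_p.
  have pxy : p x -> p y by move=> px; apply: closed_p px Axy; rewrite !inE eqxx ?orbT.
  have pyx : p y -> p x.
    move=> py; apply: closed_p py _; rewrite ?inE ?eqxx ?orbT //.
    by move=> Ayx; apply/Axy/zA.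
  by move=> a b; rewrite !inE => /orP[]/eqP-> /orP[]/eqP->.
have {mxy} : (A x y * A y x <= 4)%ZZ.
  by move: mxy; rewrite minor2 !diagA //; lia.
move: Axy; move: (A x y) (A y x) => a b a0 ab zb zbx b0 aN.
(* Both entries lie between -4 and -1: sixteen cases. *)
have b1 : (b <= -1)%ZZ by lia.
have a4 : (-4 <= a <= -1)%ZZ by nia.
have b4 : (-4 <= b <= -1)%ZZ by nia.
have [aE|[aE|[aE|aE]]] : (a = -1 \/ a = -2 \/ a = -3 \/ a = -4)%ZZ by lia.
all: have [bE|[bE|[bE|bE]]] : (b = -1 \/ b = -2 \/ b = -3 \/ b = -4)%ZZ by lia.
all: subst a b; try done; exfalso; lia.
Qed.

Definition grow (R : seq (seq bond)) : seq (seq bond) := [seq b :: r | r <- R, b <- bonds].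

Definition admissible (A : nat -> nat -> Z) (s : seq nat) : bool :=
  if conn A s then Z.leb 0 (minor A s) else true.

(** The rows by which a vertex can be adjoined to [M] while no connected diagram
    met on the way has negative determinant.  The bonds with the older vertices
    are chosen first. *)
Fixpoint rows (M : diagram) : seq (seq bond) :=
  if M is _ :: M' then
    [seq r <- grow (rows M') | admissible (entry (r :: M)) (iota 0 (size M).+1)]
  else [:: [::]].

(** No determinant is tested after the choice of the bond with the first vertex of
    [M]: the diagram is then complete, and as a hyperbolic diagram it may have
    negative determinant. *)
Definition exts (M : diagram) : seq diagram :=
  [seq r :: M | r <- grow (rows (behead M))].

(** [s] numbers the vertices of [A] as they occur in [M]. *)
Definition describes (M : diagram) (A : nat -> nat -> Z) (s : seq nat) : Prop :=
  size M = size s /\ forall i j, (i < size s)%N -> (j < size s)%N ->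
    entry M i j = A (nth 0%N s i) (nth 0%N s j).

(** A list of rows has the type of what it describes. *)
Section Describes.
Variables (M : diagram) (A : nat -> nat -> Z) (s : seq nat).
Hypotheses (us : uniq s) (Ms : describes M A s).

Let g := nth 0%N s.

Let g_inj : {in iota 0 (size M) &, injective g}.
Proof.
have [-> _] := Ms => i j; rewrite !mem_iota !add0n /= => lti ltj /eqP.
by rewrite nth_uniq // => /eqP.
Qed.

Let gE : {in iota 0 (size M) &, forall x y, entry M x y = A (g x) (g y)}.
Proof.
by have [-> MA] := Ms => i j; rewrite !mem_iota !add0n /= => lti ltj; apply: MA.
Qed.

Let map_g : map g (iota 0 (size M)) = s.
Proof. by have [-> _] := Ms; apply: mkseq_nth. Qed.

Lemma describes_finaff : finaff (entry M) (iota 0 (size M)) <-> finaff A s.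
Proof. by rewrite -map_g; apply: (finaff_map g_inj gE). Qed.

Lemma describes_hyper : hyper (entry M) (iota 0 (size M)) <-> hyper A s.
Proof. by rewrite -map_g; apply: (hyper_map g_inj gE). Qed.

Lemma describes_linked : linked (entry M) (iota 0 (size M)) <-> linked A s.
Proof. by rewrite -map_g; apply: (linked_map g_inj gE). Qed.

Lemma describes_zero_sym : zero_sym A s -> zero_sym (entry M) (iota 0 (size M)).
Proof.
have gs x : x \in iota 0 (size M) -> g x \in s by move=> mx; rewrite -map_g map_f.
by move=> zs x y mx my; rewrite !gE //; apply: zs; apply: gs.
Qed.

Lemma describes_admissible u :
  zero_sym A s -> uniq u -> {subset u <= iota 0 (size M)} ->
  (linked A (map g u) -> (0 <= minor A (map g u))%ZZ) ->
  admissible (entry M) u.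
Proof.
move=> zs uu su mu; rewrite /admissible; case: ifP => // cu; apply/Z.leb_le.
rewrite (minor_map gE su); apply: mu; apply/(linked_map g_inj gE su).
by apply: conn_linked cu => x y /su sx /su sy; apply: describes_zero_sym.
Qed.

Lemma map_nth_sub u : uniq u -> {subset u <= iota 0 (size M)} ->
  uniq (map g u) /\ {subset map g u <= s}.
Proof.
move=> uu su; split.
  by rewrite map_inj_in_uniq // => x y /su sx /su sy; apply: g_inj.
by move=> _ /mapP[x /su mx ->]; rewrite -map_g map_f.
Qed.
End Describes.

Definition bond_row (A : nat -> nat -> Z) (v : nat) (t : seq nat) : seq bond :=
  [seq (A v w, A w v) | w <- t].

Lemma describes_cons M A v t : A v v = 2%ZZ -> describes M A t ->
  describes (bond_row A v t :: M) A (v :: t).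
Proof.
move=> Av [szM MA]; split; first by rewrite /= szM.
case=> [|i] [|j] //= lti ltj; rewrite ?(nth_map 0%N) //.
exact: MA.
Qed.

Lemma describes_behead M A w t : describes M A (w :: t) ->
  describes (behead M) A t.
Proof. by case: M => [|r M] [] // [szM] MA; split=> // i j lti ltj; apply: (MA i.+1 j.+1). Qed.

Lemma mem_grow b r R : b \in bonds -> r \in R -> b :: r \in grow R.
Proof. by move=> bb rR; apply: (allpairs_f (fun r b => b :: r)). Qed.

Lemma sub_gcm A (s t : seq nat) : {subset t <= s} -> gcm A s -> gcm A t.
Proof.
move=> ts [dA oA zA]; split.
- by move=> x /ts; apply: dA.
- by move=> x y /ts sx /ts sy; apply: oA.
- by move=> x y /ts sx /ts sy; apply: zA.
Qed.

(** Each partial row is the row of [v] relative to a final segment of [t], and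
    with [v] this segment spans a subdiagram of a tame diagram. *)
Lemma mem_rows M A v t : uniq (v :: t) -> gcm A (v :: t) -> describes M A t ->
  tame A (v :: t) -> bond_row A v t \in rows M.
Proof.
elim: t M => [|w t IH] M uvt gA MA tA.
  by case: MA => /size0nil ->.
case: M MA => [[]//|r M] MA; have MA' := describes_behead MA.
have sub : {subset v :: t <= [:: v, w & t]}.
  by move=> x; rewrite !inE => /orP[]->; rewrite ?orbT.
have uvt' : uniq (v :: t) by move: uvt; rewrite /= inE negb_or => /and3P[/andP[_ ->] _ ->].
have [dA _ zA] := gA.
rewrite /= mem_filter; apply/andP; split.
  have dN := describes_cons (dA v (mem_head _ _)) MA.
  have szN := dN.1; rewrite /= in szN.
  have uN : uniq (iota 0 (size M).+2) by apply: iota_uniq.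
  apply: (describes_admissible uvt dN zA uN) => //; set u := iota _ _ => lu.
  have [|uu su] := map_nth_sub uvt dN uN; first by [].
  exact: tA.
apply: mem_grow; last first.
  apply: IH => //; first exact: sub_gcm gA.
  by move=> u uu su; apply: tA => // x /su /sub.
apply: (tame_bond gA); rewrite ?mem_head ?inE ?eqxx ?orbT //.
  by move: uvt; rewrite /= inE negb_or => /andP[/andP[]].
apply: tA; first by move: uvt; rewrite /= !inE negb_or => /andP[/andP[-> _] _].
by move=> x; rewrite !inE => /orP[]->; rewrite ?orbT.
Qed.

Lemma mem_exts M A v w t : uniq [:: v, w & t] -> gcm A [:: v, w & t] ->
  describes M A (w :: t) -> proper_tame A [:: v, w & t] ->
  (A v w, A w v) \in bonds ->
  bond_row A v (w :: t) :: M \in exts M.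
Proof.
move=> uvt gA MA tA bw; apply: (map_f (cons^~ M)); apply: mem_grow => //.
have sub : {subset v :: t <= [:: v, w & t]}.
  by move=> x; rewrite !inE => /orP[]->; rewrite ?orbT.
apply: mem_rows (describes_behead MA) _.
- by move: uvt; rewrite /= inE negb_or => /and3P[/andP[_ ->] _ ->].
- exact: sub_gcm gA.
- move=> u uu su lu; apply: tA => //; first by move=> x /su /sub.
  exact: (uniq_leq_size uu su).
Qed.

(** A cheap necessary condition, which discards most candidates before they are
    compared up to isomorphism and before all their minors are computed. *)
Definition plausible (M : diagram) : bool :=
  let s := iota 0 (size M) in
  if conn (entry M) s then
    all (fun v => admissible (entry M) (filter (predC1 v) s)) s
  else false.

Lemma describes_plausible M A s : uniq s -> zero_sym A s -> describes M A s ->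
  linked A s -> proper_tame A s -> plausible M.
Proof.
move=> us zs MA ls ts; rewrite /plausible.
rewrite linked_conn ?iota_uniq //; last exact/(describes_linked us MA).
apply/allP => v mv; set u := filter _ _.
have uu : uniq u by rewrite filter_uniq ?iota_uniq.
have su : {subset u <= iota 0 (size M)} by move=> x; rewrite mem_filter => /andP[].
apply: (describes_admissible us MA zs uu su) => lu.
have [ug sg] := map_nth_sub us MA uu su; apply: ts => //.
rewrite size_map -MA.1 -(size_iota 0 (size M)) size_filter.
rewrite -(count_predC (pred1 v) (iota 0 (size M))) -addn1 addnC leq_add2r.
by rewrite -has_count has_pred1.
Qed.

(** * Isomorphism and its classes *)

(** The list [p] holds the images of the vertices i, ..., n - 1, and the images
    of smaller vertices are chosen in descending order.  In this order each
    vertex is adjacent to an earlier one for the diagrams built below, which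
    keeps the branching small. *)
Fixpoint search (n : nat) (A B : nat -> nat -> Z) (i : nat) (p : seq nat) : bool :=
  if i is i'.+1 then
    has (fun c =>
      let q := c :: p in
      if (c \notin p) &&
         all (fun k => Z.eqb (A i' (i' + k)%N) (B c (nth 0%N q k)) &&
                       Z.eqb (A (i' + k)%N i') (B (nth 0%N q k) c)) (iota 0 (size q))
      then search n A B i' q else false) (iota 0 n)
  else true.

Definition same (M N : diagram) : bool :=
  if size M == size N then search (size M) (entry M) (entry N) (size M) [::]
  else false.

Definition matching (n : nat) (A B : nat -> nat -> Z) (i : nat) (p : seq nat) : Prop :=
  [/\ uniq p, {subset p <= iota 0 n}, (size p + i = n)%N &
      forall k l, (k < size p)%N -> (l < size p)%N ->
      A (i + k)%N (i + l)%N = B (nth 0%N p k) (nth 0%N p l)].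

Lemma search_sound n A B i p : matching n A B i p -> search n A B i p ->
  exists q, matching n A B 0 q.
Proof.
elim: i p => [|i IH] p mp; first by exists p.
case/hasP=> c nc; lazy beta zeta; case: ifP => // /andP[cp /allP cP]; apply: IH.
have [up sp szp pP] := mp; split; rewrite /= ?cp //.
- by move=> x; rewrite inE => /predU1P[->|/sp].
- by rewrite addSnnS.
have q1 k : (k < (size p).+1)%N -> A i (i + k)%N = B c (nth 0%N (c :: p) k) /\
    A (i + k)%N i = B (nth 0%N (c :: p) k) c.
  move=> ltk; have kp : k \in iota 0 (size p).+1 by rewrite mem_iota.
  by have /andP[/Z.eqb_spec E1 /Z.eqb_spec E2] := cP k kp.
case=> [|k] [|l] ltk ltl.
- by rewrite addn0; have [] := q1 0%N isT; rewrite addn0.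
- by rewrite addn0; have [] := q1 l.+1 ltl.
- by rewrite addn0; have [] := q1 k.+1 ltk.
- by rewrite -!addSnnS; apply: pP.
Qed.

Lemma search_complete n A B q : matching n A B 0 q ->
  search n A B n [::].
Proof.
move=> [uq sq]; rewrite addn0 => szq qP.
rewrite -[[::]](drop_size q) szq; have := leqnn n.
elim: {1 4 5}n => // i IH lti; apply/hasP; exists (nth 0%N q i).
  by apply: sq; apply: mem_nth; rewrite szq.
have dE : nth 0%N q i :: drop i.+1 q = drop i q by rewrite -drop_nth ?szq.
have /andP[ni _] : uniq (nth 0%N q i :: drop i.+1 q) by rewrite dE drop_uniq.
lazy beta zeta; rewrite dE; case: ifP => [_|/negP[]]; first exact/IH/ltnW.
rewrite ni; apply/allP => k; rewrite size_drop mem_iota add0n /= szq => ltk.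
have lts : (i + k < size q)%N by rewrite szq; lia.
rewrite nth_drop !qP ?szq //; rewrite -?szq ?szq ?Z.eqb_refl //; lia.
Qed.

Lemma same_matchingP M N : size M = size N ->
  reflect (exists p, matching (size M) (entry M) (entry N) 0 p) (same M N).
Proof.
move=> szMN; rewrite /same szMN eqxx -szMN; apply: (iffP idP) => [|[p]].
  by apply: search_sound; split.
exact: search_complete.
Qed.

Lemma same_describes M N A s : same M N -> describes N A s ->
  exists2 s', perm_eq s' s & describes M A s'.
Proof.
move=> sMN; have szMN : size M = size N by move: sMN; rewrite /same; case: eqP.
have /(same_matchingP szMN)[p [up sp szp pP]] := sMN => -[szN NA].
rewrite addn0 in szp.
have pE : perm_eq p (iota 0 (size s)).
  rewrite szMN szN in sp szp; apply: uniq_perm; rewrite ?iota_uniq //.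
  by have [] := uniq_min_size up sp; rewrite ?size_iota ?szp.
have szps : size p = size s by rewrite (perm_size pE) size_iota.
exists (map (nth 0%N s) p).
  by rewrite -[X in perm_eq _ X](mkseq_nth 0%N); apply: perm_map.
split; first by rewrite size_map szp.
move=> i j; rewrite size_map => lti ltj; rewrite (pP i j) // !(nth_map 0%N) //.
by apply: NA; have := mem_nth 0%N lti; have := mem_nth 0%N ltj; rewrite !(perm_mem pE) !mem_iota.
Qed.

Fixpoint dedup (acc s : seq diagram) : seq diagram :=
  if s is M :: s' then
    if has (same^~ M) acc then dedup acc s' else dedup (M :: acc) s'
  else acc.

Lemma dedup_sub acc s : {subset dedup acc s <= acc ++ s}.
Proof.
elim: s acc => [|M s IH] acc /=; first by rewrite cats0.
move=> N; case: ifP => _ /IH; rewrite !mem_cat !inE.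
  by case/orP=> ->; rewrite ?orbT.
by case/orP=> [/orP[]|] ->; rewrite ?orbT.
Qed.

Lemma dedup_pairwise acc s : pairwise (fun M N => ~~ same N M) acc ->
  pairwise (fun M N => ~~ same N M) (dedup acc s).
Proof.
elim: s acc => //= M s IH acc pacc; case: ifP => no; apply: IH => //=.
by rewrite pacc andbT all_predC no.
Qed.

Lemma dedup_acc acc s : {subset acc <= dedup acc s}.
Proof.
elim: s acc => [|M s IH] acc N accN //=; case: ifP => _; apply: IH => //.
by rewrite inE accN orbT.
Qed.

(** A discarded entry is isomorphic to one that has been kept, so the kept one
    describes the same array, with its vertices listed in another order. *)
Lemma dedup_describes acc s M A t : M \in s -> describes M A t ->
  exists2 N, N \in dedup acc s & exists2 t', perm_eq t' t & describes N A t'.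
Proof.
elim: s acc => //= N s IH acc; rewrite inE => /predU1P[<-|sM] MA; last by case: ifP => _; apply: IH.
case: ifP => [/hasP[N' accN' sN]|_].
  by exists N'; [apply: dedup_acc|apply: same_describes MA].
by exists M; [apply: dedup_acc; apply: mem_head|exists t].
Qed.

(** * Enumeration rank by rank *)

Definition step (L : seq diagram) : seq diagram :=
  dedup [::] [seq N <- flatten [seq exts M | M <- L] | plausible N].

Definition finaff_class (M : diagram) : bool :=
  let s := iota 0 (size M) in finaff_in (entry M) (nonpos (entry M) s) s.

Definition hyper_class (M : diagram) : bool :=
  let s := iota 0 (size M) in hyper_in (entry M) (nonpos (entry M) s) s.

Definition complete (L : seq diagram) (n : nat) (P : (nat -> nat -> Z) -> seq nat -> Prop) :=
  forall A s, uniq s -> gcm A s -> size s = n -> P A s ->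
  exists2 M, M \in L & exists2 t, perm_eq t s & describes M A t.

(** Removing a suitable vertex leaves a finite or affine diagram, which some
    entry of [L] describes, and the vertex is adjoined again to that entry.  The
    hypothesis on [P] gathers what finite or affine type and hyperbolicity have
    in common; its last part, on pairs, is automatic from the second one for
    rank at least 3 and is what fails for hyperbolic diagrams of rank 2. *)
Lemma step_complete L n (P : (nat -> nat -> Z) -> seq nat -> Prop) :
  complete L n.+1 finaff ->
  (forall A s, uniq s -> size s = n.+2 -> P A s ->
    [/\ linked A s, proper_tame A s,
        forall t, uniq t -> {subset t <= s} -> (size t < size s)%N -> linked A t -> finaff A t &
        {in s &, forall x y, x != y -> linked A [:: x; y] -> (0 <= minor A [:: x; y])%ZZ}]) ->
  complete (step L) n.+2 P.
Proof.
move=> cL Pfa A s us gA szs /(Pfa _ _ us szs)[ls ts fs bs].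
have [dA _ zA] := gA; have gt1 : (1 < size s)%N by rewrite szs.
have [v [t [st lt]]] := linked_noncut us zA ls gt1.
have uvt : uniq (v :: t) by rewrite -(perm_uniq st).
have szt : size t = n.+1 by have := perm_size st; rewrite szs => -[].
have sub_ts : {subset t <= s} by move=> x tx; rewrite (perm_mem st) inE tx orbT.
have [M LM [t' tt' MA]] : exists2 M, M \in L & exists2 t', perm_eq t' t & describes M A t'.
  have ut : uniq t by case/andP: uvt.
  apply: cL => //; first exact: sub_gcm gA.
  by apply: fs => //; rewrite szs szt.
have st' : perm_eq s (v :: t') by rewrite (permPl st) perm_cons perm_sym.
have uvt' : uniq (v :: t') by rewrite -(perm_uniq st').
have szt' : size t' = n.+1 by rewrite (perm_size tt').
have svt' : {subset v :: t' <= s} by move=> x; rewrite (perm_mem st').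
have gvt' : gcm A (v :: t') by apply: sub_gcm gA.
have tvt' : proper_tame A (v :: t').
  by move=> u uu su; rewrite -(perm_size st'); apply: ts => // x /su /svt'.
have [dA' _ _] := gvt'; have dv := dA' v (mem_head _ _).
have NA := describes_cons dv MA.
have lvt' : linked A (v :: t') by apply: linked_eq_mem ls; apply: perm_mem.
have [zA' pN] : zero_sym A (v :: t') /\ plausible (bond_row A v t' :: M).
  by case: gvt' => _ _ zA'; split=> //; apply: describes_plausible NA lvt' tvt'.
have NM : bond_row A v t' :: M \in exts M.
  case: t' {tt'} MA szt' uvt' svt' gvt' tvt' {st' dA' NA lvt' zA' pN}
    => // w t' MA _ uvt' svt' gvt' tvt'.
  apply: mem_exts => //.
  have vs : v \in s by apply: svt'; apply: mem_head.
  have ws : w \in s by apply: svt'; rewrite !inE eqxx orbT.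
  have vw : v != w by move: uvt'; rewrite /= inE negb_or => /andP[/andP[]].
  by apply: (tame_bond gA) => //; apply: bs.
have N_in : bond_row A v t' :: M \in
    [seq N <- flatten [seq exts M | M <- L] | plausible N].
  by rewrite mem_filter pN; apply/flatten_mapP; exists M.
have [N' N'in [u uE N'A]] := dedup_describes [::] N_in NA.
by exists N' => //; exists u => //; rewrite (permPl uE) perm_sym.
Qed.

Lemma step_finaff_complete L n : complete L n.+1 finaff -> complete (step L) n.+2 finaff.
Proof.
move/step_complete; apply=> A s us _ fs; have ts := finaff_tame us fs.
split; first by case: fs.
- by move=> u uu su _; apply: ts.
- by move=> t ut st _; apply: finaff_sub fs ut st.
- move=> x y sx sy xy; apply: ts; first by rewrite /= inE xy.
  by move=> z; rewrite !inE => /orP[]/eqP->.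
Qed.

Lemma step_hyper_complete L n : complete L n.+2 finaff -> complete (step L) n.+3 hyper.
Proof.
move/step_complete; apply=> A s us szs hs; have ts := hyper_tame hs.
split=> //; [by case: hs|by case: hs|].
move=> x y sx sy xy; apply: ts; last by rewrite szs.
  by rewrite /= inE xy.
by move=> z; rewrite !inE => /orP[]/eqP->.
Qed.

Lemma complete_filter (c : pred diagram) L n
    (P : (nat -> nat -> Z) -> seq nat -> Prop) :
  (forall M A s, uniq s -> gcm A s -> describes M A s -> P A s -> c M) ->
  (forall A s t, perm_eq s t -> P A s -> P A t) ->
  complete L n P -> complete (filter c L) n P.
Proof.
move=> cP Pperm cL A s us gA szs Ps; have [M LM [t ts MA]] := cL A s us gA szs Ps.
exists M; last by exists t.
rewrite mem_filter LM andbT; apply: cP MA _.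
- by rewrite (perm_uniq ts).
- by apply: sub_gcm gA => x; rewrite (perm_mem ts).
- by apply: Pperm Ps; rewrite perm_sym.
Qed.

Lemma finaff_classP M : zero_sym (entry M) (iota 0 (size M)) ->
  reflect (finaff (entry M) (iota 0 (size M))) (finaff_class M).
Proof.
move=> zM; apply: finaff_inP => //; first exact: iota_uniq.
by rewrite -{1}(filter_predT (iota 0 (size M))) filter_sublists.
Qed.

Lemma hyper_classP M : zero_sym (entry M) (iota 0 (size M)) ->
  reflect (hyper (entry M) (iota 0 (size M))) (hyper_class M).
Proof. by move=> zM; apply: hyper_inP => //; apply: iota_uniq. Qed.

(** At stage [n]: the finite or affine diagrams of rank n + 1, and the hyperbolic
    ones of all ranks up to n + 1, where those of rank 2 are incomplete because
    only the bonds in [bonds] are tried. *)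
Fixpoint tower (n : nat) : seq diagram * seq diagram :=
  if n is n'.+1 then
    let r := tower n' in
    let C := step r.1 in
    (filter finaff_class C, filter hyper_class C ++ r.2)
  else ([:: [:: [::]]], [::]).


Lemma size_step L n N : {in L, forall M, size M = n.+1} -> N \in step L ->
  size N = n.+2.
Proof.
move=> szL /dedup_sub; rewrite /= mem_filter => /andP[_ /flatten_mapP[M /szL szM]].
by case/mapP=> r _ ->; rewrite /= szM.
Qed.

Lemma tower_size n : {in (tower n).1, forall M, size M = n.+1} /\
  {in (tower n).2, forall M, (size M <= n.+1)%N}.
Proof.
elim: n => [|n [IH1 IH2]]; first by split=> // M; rewrite inE => /eqP->.
split=> M /=; first by rewrite mem_filter => /andP[_]; apply: size_step.
rewrite mem_cat mem_filter => /orP[/andP[_ /(size_step IH1) ->]//|/IH2].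
by apply: leqW.
Qed.

(** Diagrams found at different stages have different ranks, and those of one stage
    have been compared by [dedup]. *)
Lemma tower_pairwise n : pairwise (fun M N => ~~ same N M) (tower n).2.
Proof.
elim: n => //= n IH; have [sz1 sz2] := tower_size n.
rewrite pairwise_cat IH andbT; apply/andP; split; last first.
  by apply: pairwise_filter; apply: dedup_pairwise.
apply/allrelP => M N; rewrite mem_filter => /andP[_ /(size_step sz1) szM] /sz2 szN.
by rewrite /same szM; case: eqP => // szE; rewrite szE ltnn in szN.
Qed.

Lemma tower_hyper n : {in (tower n).2, forall M, hyper_class M}.
Proof.
elim: n => //= n IH M; rewrite mem_cat mem_filter => /orP[/andP[]//|].
exact: IH.
Qed.

Lemma tower_finaff_complete n : complete (tower n).1 n.+1 finaff.
Proof.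
elim: n => [|n IH].
  move=> A s us [dA _ _] szs _; exists [:: [::]]; first exact: mem_head.
  exists s => //; split=> // i j; rewrite szs !ltnS !leqn0 => /eqP-> /eqP->.
  by rewrite dA // mem_nth // szs.
apply: complete_filter (step_finaff_complete IH).
  move=> M A s us [_ _ zA] MA fs; apply/finaff_classP; first exact: describes_zero_sym MA zA.
  exact/(describes_finaff us MA).
exact: finaff_perm.
Qed.

Lemma tower_hyper_complete n m : (3 <= m <= n.+1)%N -> complete (tower n).2 m hyper.
Proof.
elim: n => [|n IH]; first by case: m => [|[|[]]].
case/andP=> m3; rewrite leq_eqVlt => /orP[/eqP mE|ltm]; last first.
  move=> A s us gA szs hs; have [|M HM Ms] := IH _ A s us gA szs hs; first by rewrite m3.
  by exists M => //; rewrite /= mem_cat HM orbT.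
case: n mE m3 {IH} => [-> //|n mE _].
have cH : complete (filter hyper_class (step (tower n.+1).1)) n.+3 hyper.
  apply: complete_filter (step_hyper_complete (@tower_finaff_complete n.+1)).
    move=> M A s us [_ _ zA] MA fs; apply/hyper_classP; first exact: describes_zero_sym MA zA.
    exact/(describes_hyper us MA).
  exact: hyper_perm.
move=> A s us gA; rewrite mE => szs hs; have [M HM Ms] := cH A s us gA szs hs.
by exists M => //; rewrite [(tower _).2]/= mem_cat HM.
Qed.

(** * From lists of rows to Dynkin diagrams *)

(** Besides the shape and the bonds, each vertex but the oldest is required to
    be joined to an older one. *)
Fixpoint valid (M : diagram) : bool :=
  if M is r :: M' then
    [&& size r == size M', all (mem bonds) r,
        (M' == [::]) || has (fun b => ~~ Z.eqb b.1 0) r & valid M']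
  else true.

Lemma bondsP b : b \in bonds ->
  [/\ (b.1 <= 0)%ZZ, b.1 = 0%ZZ -> b.2 = 0%ZZ,
      b.1 <> 0%ZZ -> b.2 <> 0%ZZ & (b.2, b.1) \in bonds].
Proof.
have /allP bP : all (fun b => [&& Z.leb b.1 0, Z.eqb b.1 0 == Z.eqb b.2 0
    & (b.2, b.1) \in bonds]) bonds by [].
move/bP => /and3P[/Z.leb_spec0 b1 /eqP b0 ->]; split=> //; move: b0.
  by case: (Z.eqb_spec b.2 0) => // _ + b10; rewrite b10.
by case: (Z.eqb_spec b.1 0) => // _; case: (Z.eqb_spec b.2 0).
Qed.

Lemma entry_bonds M i j : valid M -> i != j -> (entry M i j, entry M j i) \in bonds.
Proof.
elim: M i j => [|r M IH] [|i] [|j] //= /and4P[_ /allP rb _ vM]; last by rewrite eqSS; apply: IH.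
  move=> _; have [lt|ge] := ltnP j (size r); last by rewrite nth_default.
  by have := rb _ (mem_nth (0, 0)%ZZ lt); rewrite /= -surjective_pairing.
move=> _; have [lt|ge] := ltnP i (size r); last by rewrite nth_default.
by have /bondsP[] := rb _ (mem_nth (0, 0)%ZZ lt).
Qed.

Lemma entry_diag M i : (i < size M)%N -> entry M i i = 2%ZZ.
Proof. by elim: M i => [|r M IH] [|i] //= lti; apply: IH. Qed.

Definition matrix_of (M : diagram) : 'M[int]_(size M) :=
  (\matrix_(i < size M, j < size M) int_of_Z (entry M i j))%R.

Lemma matrix_of_gcm M : valid M -> is_gcm (matrix_of M).
Proof.
move=> vM; apply/and3P; split; apply/forallP => i.
- by rewrite mxE entry_diag.
- apply/forallP => j; apply/implyP => ij; rewrite mxE.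
  by have /bondsP[/= + _ _ _] := entry_bonds vM ij; lia.
- apply/forallP => j; apply/implyP; rewrite !mxE => /eqP A0.
  have [ij|ij] := eqVneq (i : nat) j; first by move: A0; rewrite ij => ->.
  have /bondsP[/= _ + _ _] := entry_bonds vM ij; move=> -> //.
  by rewrite -[LHS]int_of_ZK A0.
Qed.

Definition dynkin_of (M : diagram) (vM : valid M) : dynkin :=
  Dynkin (matrix_of_gcm vM).

Lemma cartanZ_dynkin_of M (vM : valid M) i j : (i < size M)%N -> (j < size M)%N ->
  cartanZ (dynkin_of vM) i j = entry M i j.
Proof.
move=> lti ltj.
pose i' : 'I_(rank (dynkin_of vM)) := Ordinal lti.
pose j' : 'I_(rank (dynkin_of vM)) := Ordinal ltj.
by rewrite -[i]/(val i') -[j]/(val j') cartanZE mxE int_of_ZK.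
Qed.

Lemma dynkin_of_describes M (vM : valid M) :
  describes M (cartanZ (dynkin_of vM)) (iota 0 (rank (dynkin_of vM))).
Proof.
split; first by rewrite size_iota.
by move=> i j; rewrite size_iota => lti ltj; rewrite !nth_iota // !add0n cartanZ_dynkin_of.
Qed.

Lemma describes_isomorphic M (vM : valid M) D t :
  perm_eq t (iota 0 (rank D)) -> describes M (cartanZ D) t ->
  isomorphic (dynkin_of vM) D.
Proof.
move=> tD [szM MD]; have szt : size t = rank D by rewrite (perm_size tD) size_iota.
have ltf (i : 'I_(size M)) : (nth 0%N t i < rank D)%N.
  have lti : (i < size t)%N by rewrite -szM.
  by have := mem_nth 0%N lti; rewrite (perm_mem tD) mem_iota.
pose f (i : 'I_(rank (dynkin_of vM))) : 'I_(rank D) := Ordinal (ltf i).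
exists f; split.
  apply: inj_card_bij; last by rewrite !card_ord /= szM szt.
  move=> i j /(congr1 val)/= /eqP; rewrite nth_uniq -?szM //; last first.
    by rewrite (perm_uniq tD) iota_uniq.
  by move/eqP/val_inj.
move=> i j; rewrite mxE MD -?szM //.
by rewrite -[nth _ _ i]/(val (f i)) -[nth _ _ j]/(val (f j)) cartanZE Z_of_intK.
Qed.

Lemma isomorphic_same M N (vM : valid M) (vN : valid N) :
  isomorphic (dynkin_of vM) (dynkin_of vN) -> same M N.
Proof.
case=> f [bij_f fA].
have szMN : size M = size N by have := bij_eq_card bij_f; rewrite !card_ord.
apply/(same_matchingP szMN); exists (map (val \o f) (enum 'I_(size M))).
have nthE (i : 'I_(size M)) : nth 0%N (map (val \o f) (enum 'I_(size M))) i = f i.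
  by rewrite (nth_map i) ?size_enum_ord // nth_ord_enum.
split.
- rewrite map_inj_uniq ?enum_uniq //; apply: inj_comp; first exact: val_inj.
  exact: bij_inj.
- by move=> _ /mapP[i _ ->]; rewrite mem_iota /= szMN ltn_ord.
- by rewrite size_map size_enum_ord addn0.
- move=> i j; rewrite size_map size_enum_ord => lti ltj; rewrite !add0n.
  have := fA (Ordinal lti) (Ordinal ltj); rewrite !mxE.
  have := nthE (Ordinal lti); have := nthE (Ordinal ltj); rewrite /= => -> ->.
  by move/(can_inj int_of_ZK).
Qed.

(** The second hypothesis excludes isomorphisms in one direction only, which is
    enough because isomorphism is symmetric. *)
Lemma exactly_catalogue (P : dynkin -> Prop) (H : seq diagram) :
  all valid H -> pairwise (fun M N => ~~ same N M) H ->
  (forall M (vM : valid M), M \in H -> P (dynkin_of vM)) ->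
  (forall D, P D -> exists2 M, M \in H &
     exists2 t, perm_eq t (iota 0 (rank D)) & describes M (cartanZ D) t) ->
  exactly_up_to isomorphic P (size H).
Proof.
move=> /allP vH pH PH cH.
have memH (i : 'I_(size H)) : nth [::] H i \in H by apply: mem_nth.
exists (fun i => dynkin_of (vH _ (memH i))); split.
- by move=> i; apply: PH.
- have lt_iso (i j : 'I_(size H)) : (i < j)%N ->
      ~ isomorphic (dynkin_of (vH _ (memH j))) (dynkin_of (vH _ (memH i))).
    move=> ij /isomorphic_same sji.
    by have /(pairwiseP [::])/(_ i j (ltn_ord i) (ltn_ord j) ij) := pH; rewrite sji.
  move=> i j ij; case: (ltngtP i j) => [lt|gt|/val_inj //].
    by case: (lt_iso i j lt); apply: isomorphic_sym.
  by case: (lt_iso j i gt).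
- move=> D /cH[M HM [t tD MD]]; have ltM : (index M H < size H)%N by rewrite index_mem.
  exists (Ordinal ltM); apply: isomorphic_sym; apply: describes_isomorphic tD _.
  by rewrite /= nth_index.
Qed.

(** * Symmetrizability *)

Definition symmetrized (A : nat -> nat -> rat) (n : nat) (e : nat -> rat) : Prop :=
  forall i j, (i < n)%N -> (j < n)%N -> (e i * A i j = e j * A j i)%R.

Definition ratZ (z : Z) : rat := ((int_of_Z z)%:~R)%R.

Lemma ratZM x y : ratZ (Z.mul x y) = (ratZ x * ratZ y)%R.
Proof. by rewrite /ratZ -[Z.mul x y]/(x * y)%R (rmorphM int_of_Z) intrM. Qed.

Lemma ratZ_inj : injective ratZ.
Proof. by move=> x y /intr_inj/(can_inj int_of_ZK). Qed.

Lemma ratZ_eq0 x : (ratZ x == 0%R) = Z.eqb x 0.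
Proof. by rewrite -[0%R]/(ratZ 0%ZZ) (inj_eq ratZ_inj). Qed.

Lemma symmetrizableP D : symmetrizable D <->
  exists e, (forall i, (i < rank D)%N -> e i != 0%R) /\
    symmetrized (fun i j => ratZ (cartanZ D i j)) (rank D) e.
Proof.
have symE (d : 'rV[rat]_(rank D)) :
    (let B := diag_mx d *m map_mx intr (cartan D) in B^T = B)%R <->
    forall i j, (d 0 i * (cartan D i j)%:~R = d 0 j * (cartan D j i)%:~R)%R.
  rewrite mul_diag_mx /=; split=> [/matrixP dA i j|dA].
    by have := dA j i; rewrite !mxE.
  by apply/matrixP => i j; rewrite !mxE.
split=> [[d [d0 /symE dA]]|[e [e0 eA]]].
  exists (fun i => if insub i is Some i' then d 0 i' else 0)%R; split.
    by move=> i lti; rewrite insubT.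
  move=> i j lti ltj; rewrite !insubT -[i]/(val (Ordinal lti)) -[j]/(val (Ordinal ltj)).
  by rewrite !cartanZE /ratZ !Z_of_intK dA.
exists (\row_i e i)%R; split; first by move=> i; rewrite mxE e0.
apply/symE => i j; rewrite !mxE; have := eA i j (ltn_ord i) (ltn_ord j).
by rewrite !cartanZE /ratZ !Z_of_intK.
Qed.

Lemma isomorphic_symmetrizable D E : isomorphic D E -> symmetrizable D ->
  symmetrizable E.
Proof.
case=> f [[g fK gK] fA] [d [d0 dA]]; exists (\row_i d ord0 (g i))%R; split.
  by move=> i; rewrite mxE.
apply/matrixP => i j; have /matrixP/(_ (g i) (g j)) := dA.
by rewrite !mul_diag_mx !mxE -!fA !gK.
Qed.

(** Let b = (a_0k, a_k0) be the first nonzero bond of the new vertex, and d a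
    vector for the older ones.  The equation d_0 a_0k = d_k a_k0 is solved
    without division by scaling d by a_0k. *)
Fixpoint symmetrizer (M : diagram) : seq Z :=
  match M with
  | [::] => [::]
  | [:: _] => [:: 1%ZZ]
  | r :: M' =>
      let d := symmetrizer M' in
      let k := find (fun b => ~~ Z.eqb b.1 0) r in
      let b := nth (0, 0)%ZZ r k in
      Z.mul (nth 0%ZZ d k) b.2 :: map (Z.mul b.1) d
  end.

Definition symmetrized_by_candidate (M : diagram) : bool :=
  let d := symmetrizer M in
  let s := iota 0 (size M) in
  all (fun i => all (fun j =>
    Z.eqb (nth 0%ZZ d i * entry M i j)%ZZ (nth 0%ZZ d j * entry M j i)%ZZ) s) s.

Lemma size_symmetrizer M : valid M -> size (symmetrizer M) = size M.
Proof.
elim: M => [|r [|r' M] IH] // /and4P[_ _ _ /IH].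
by rewrite [symmetrizer (r :: _)]/= /= size_map => ->.
Qed.

Lemma symmetrizer_cons r M : M != [::] ->
  let k := find (fun b => ~~ Z.eqb b.1 0) r in
  let b := nth (0, 0)%ZZ r k in
  symmetrizer (r :: M) =
    Z.mul (nth 0%ZZ (symmetrizer M) k) b.2 :: map (Z.mul b.1) (symmetrizer M).
Proof. by case: M. Qed.

Lemma valid_bond r M : valid (r :: M) -> M != [::] ->
  let k := find (fun b => ~~ Z.eqb b.1 0) r in
  let b := nth (0, 0)%ZZ r k in
  [/\ (k < size M)%N, ratZ b.1 != 0%R & ratZ b.2 != 0%R].
Proof.
case/and4P=> /eqP szr /allP rb /orP[->//|r0] vM _ k b.
have ltk : (k < size r)%N by rewrite -has_find.
have b10 : b.1 <> 0%ZZ.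
  by have := nth_find (0, 0)%ZZ r0; rewrite -/k -/b; case: Z.eqb_spec.
have /bondsP[_ _ /(_ b10) b20 _] := rb b (mem_nth _ ltk).
by rewrite -szr ltk !ratZ_eq0; split=> //; case: Z.eqb_spec.
Qed.

Lemma symmetrizer_neq0 M i : valid M -> (i < size M)%N ->
  ratZ (nth 0%ZZ (symmetrizer M) i) != 0%R.
Proof.
elim: M i => [//|r M IH] i vM; have [->|M0] := eqVneq M [::]; first by case: i.
have [ltk b1 b2] := valid_bond vM M0; have /and4P[_ _ _ vM'] := vM.
rewrite symmetrizer_cons //; case: i => [|i] lti /=.
  by rewrite ratZM mulf_neq0 // IH.
by rewrite (nth_map 0%ZZ) ?size_symmetrizer // ratZM mulf_neq0 // IH.
Qed.

(** By induction a solution is proportional to the computed vector on the older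
    vertices, and the bond by which the new vertex is attached determines its
    value there. *)
Lemma symmetrizer_unique M e : valid M ->
  symmetrized (fun i j => ratZ (entry M i j)) (size M) e ->
  exists c, forall i, (i < size M)%N -> e i = (c * ratZ (nth 0%ZZ (symmetrizer M) i))%R.
Proof.
elim: M e => [|r M IH] e vM eM; first by exists 0%R.
have [M0|M0] := eqVneq M [::].
  by exists (e 0%N) => i; rewrite M0; case: i => // _; rewrite mulr1.
have [ltk b1 b2] := valid_bond vM M0; have /and4P[_ _ _ vM'] := vM.
have [|c cM] := IH (e \o S) vM'; first by move=> i j lti ltj; apply: (eM i.+1 j.+1).
have := eM 0%N (find (fun b => ~~ Z.eqb b.1 0) r).+1 isT ltk.
rewrite symmetrizer_cons //=; move: ltk b1 b2.
set k := find _ _; set b := nth _ _ _ => ltk b1 b2 e0.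
exists (c / ratZ b.1)%R => -[|i] lti /=.
  have ek : e k.+1 = _ := cM k ltk.
  apply: (mulIf b1); rewrite e0 ek ratZM; field.
  exact: b1.
rewrite (nth_map 0%ZZ) ?size_symmetrizer // ratZM mulrA divfK //.
exact: cM.
Qed.

(** If some nowhere zero vector symmetrizes the matrix then so does the computed
    one, being proportional to it with a nonzero factor. *)
Lemma symmetrized_by_candidateP M (vM : valid M) :
  reflect (symmetrizable (dynkin_of vM)) (symmetrized_by_candidate M).
Proof.
set d := fun i => ratZ (nth 0%ZZ (symmetrizer M) i).
have symE : reflect (symmetrized (fun i j => ratZ (entry M i j)) (size M) d)
    (symmetrized_by_candidate M).
  have mI k : (k \in iota 0 (size M)) = (k < size M)%N by rewrite mem_iota.
  apply: (iffP allP) => [dM i j lti ltj|dM i].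
    have /allP/(_ j) := dM i (etrans (mI i) lti).
    by rewrite mI => /(_ ltj)/Z.eqb_spec E; rewrite /d -!ratZM E.
  rewrite mI => lti; apply/allP => j; rewrite mI => ltj; apply/Z.eqb_spec.
  by apply: ratZ_inj; rewrite !ratZM; apply: dM.
have cartanZE' i j : (i < size M)%N -> (j < size M)%N -> cartanZ (dynkin_of vM) i j = entry M i j.
  exact: cartanZ_dynkin_of.
apply: (iffP symE) => [dM|/symmetrizableP[e [e0 eM]]].
  apply/symmetrizableP; exists d; split; first by move=> i; apply: symmetrizer_neq0.
  by move=> i j lti ltj; rewrite !cartanZE' //; apply: dM.
have {}eM : symmetrized (fun i j => ratZ (entry M i j)) (size M) e.
  by move=> i j lti ltj; have := eM i j lti ltj; rewrite !cartanZE'.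
have [c cM] := symmetrizer_unique vM eM => i j lti ltj.
have c0 : c != 0%R.
  by apply: contraNneq (e0 i lti) => c0; rewrite cM // c0 mul0r.
by apply: (mulfI c0); rewrite !mulrA -!cM //; apply: eM.
Qed.

(** * The count *)

Definition catalogue_ok (H : seq diagram) : bool :=
  [&& all (fun M => (2 < size M)%N && valid M) H,
      size H == 238 & count symmetrized_by_candidate H == 142].

(** Stage 9 reaches rank 10.  Its hyperbolic diagrams are found by evaluation to
    number 238, none of them of rank 2. *)
Lemma catalogue_count : catalogue_ok (tower 9).2.
Proof. by vm_compute. Qed.

Lemma catalogue_complete D : (3 <= rank D <= 10)%N -> hyperbolic D ->
  exists2 M, M \in (tower 9).2 &
    exists2 t, perm_eq t (iota 0 (rank D)) & describes M (cartanZ D) t.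
Proof.
move=> rD /hyperbolicP hD.
exact: (tower_hyper_complete rD (iota_uniq _ _) (cartanZ_gcm D) (size_iota _ _) hD).
Qed.

Lemma catalogue_sound M (vM : valid M) : (2 < size M)%N -> M \in (tower 9).2 ->
  (3 <= rank (dynkin_of vM) <= 10)%N /\ hyperbolic (dynkin_of vM).
Proof.
move=> gt2 HM; split; first by rewrite gt2; apply: (tower_size 9).2 HM.
have [_ _ zD] := cartanZ_gcm (dynkin_of vM).
have MD := dynkin_of_describes vM; have uD := iota_uniq 0 (rank (dynkin_of vM)).
apply/hyperbolicP/(describes_hyper uD MD)/hyper_classP; last exact: tower_hyper HM.
exact: describes_zero_sym MD zD.
Qed.

Theorem mainTheorem3 :
  exactly_up_to isomorphic
    (fun D : dynkin => (3 <= rank D <= 10)%N /\ hyperbolic D) 238 /\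
  exactly_up_to isomorphic
    (fun D : dynkin => [/\ (3 <= rank D <= 10)%N, hyperbolic D & symmetrizable D])
    142.
Proof.
have := catalogue_count; have := @catalogue_complete; have := @catalogue_sound.
have := tower_pairwise 9; move: (tower 9).2 => H pH soundH completeH.
case/and3P=> /allP vH /eqP <- /eqP <-; rewrite -size_filter; split.
  apply: exactly_catalogue => //.
  - by apply/allP => M /vH /andP[].
  - by move=> M vM HM; apply: soundH => //; have /andP[] := vH M HM.
  - by move=> D [rD hD]; apply: completeH.
apply: exactly_catalogue.
- by apply/allP => M; rewrite mem_filter => /andP[_ /vH /andP[]].
- exact: pairwise_filter.
- move=> M vM; rewrite mem_filter => /andP[/(symmetrized_by_candidateP vM) sM HM].
  by have [] := soundH M vM _ HM; first by have /andP[] := vH M HM.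
- move=> D [rD hD sD]; have [M HM [t tD MD]] := completeH D rD hD.
  exists M; last by exists t.
  have /andP[_ vM] := vH M HM.
  rewrite mem_filter HM andbT; apply/(symmetrized_by_candidateP vM).
  by apply: isomorphic_symmetrizable sD; apply: isomorphic_sym; apply: describes_isomorphic tD MD.
Qed.
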